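(* Let $R$ be a $*$-ring. Then $R$ is strongly nil $*$-clean if and only if the following three conditions hold: (1) every idempotent in $R$ is a projection; (2) $R$ is periodic; (3) $R/J(R)$ is Boolean.
   Context: All rings are associative with unity (not necessarily commutative). An involution of a ring $R$ is a map $*:R\to R$ with $(x+y)^*=x^*+y^*$, $(xy)^*=y^*x^*$ and $(x^* )^*=x$ for all $x,y\in R$; a ring with an involution is called a $*$-ring. A projection in a $*$-ring is an element $p$ with $p^2=p=p^*$. A $*$-ring $R$ is strongly nil $*$-clean if every element of $R$ is the sum of a projection and a nilpotent element that commute with each other. A ring $R$ is periodic if for every $x\in R$ there exist distinct $m,n\in\mathbb{N}$ (positive integers) with $x^m=x^n$. $J(R)$ denotes the Jacobson radical of $R$. A ring is Boolean if every element is idempotent. *)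

(* Defs.v *)
From HB Require Import structures.
From mathcomp Require Import all_boot all_algebra.
From mathcomp Require Import boolp classical_sets.

Set Implicit Arguments.
Unset Strict Implicit.
Unset Printing Implicit Defensive.

Import GRing.Theory.

Local Open Scope classical_set_scope.
Local Open Scope quotient_scope.
Local Open Scope ring_scope.

(* Rings are [pzRingType]s: associative, unital, not necessarily commutative,
   and possibly zero. *)

Definition ring_involution (R : pzRingType) (star : R -> R) : Prop :=
  [/\ forall x y, star (x + y) = star x + star y,
      forall x y, star (x * y) = star y * star x
    & forall x, star (star x) = x].

Definition ring_idempotent (R : pzRingType) (e : R) : Prop := e ^+ 2 = e.

Definition star_projection (R : pzRingType) (star : R -> R) (p : R) : Prop :=
  p ^+ 2 = p /\ p = star p.

Definition ring_nilpotent (R : pzRingType) (w : R) : Prop :=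
  exists2 n : nat, (0 < n)%N & w ^+ n = 0.

Definition strongly_nil_star_clean (R : pzRingType) (star : R -> R) : Prop :=
  forall x : R, exists p w : R,
    [/\ star_projection star p, ring_nilpotent w, x = p + w & p * w = w * p].

Definition periodic_ring (R : pzRingType) : Prop :=
  forall x : R, exists m n : nat,
    [/\ (0 < m)%N, (0 < n)%N, m <> n & x ^+ m = x ^+ n].

Definition boolean_ring (R : pzRingType) : Prop :=
  forall x : R, ring_idempotent x.

Definition left_ideal (R : pzRingType) (I : set R) : Prop :=
  [/\ I 0, forall x y, I x -> I y -> I (x + y) & forall a x, I x -> I (a * x)].

Definition maximal_left_ideal (R : pzRingType) (M : set R) : Prop :=
  [/\ left_ideal M, M <> setT &
      forall I : set R, left_ideal I -> M `<=` I -> I = M \/ I = setT].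

(* It is all of R when R is the zero ring, which has no maximal left ideal. *)
Definition jacobson_radical (R : pzRingType) : set R :=
  [set x | forall M : set R, maximal_left_ideal M -> M x].

Section JacobsonQuotient.
Variable R : pzRingType.

Lemma left_idealN (I : set R) x : left_ideal I -> I x -> I (- x).
Proof. by case=> _ _ IM Ix; rewrite -mulN1r; apply: IM. Qed.

Lemma jacobson_left_ideal : left_ideal (@jacobson_radical R).
Proof.
split=> [M [[]] // | x y Jx Jy M maxM | a x Jx M maxM].
- by case: (maxM) => -[_ MD _] _ _; apply: MD; [apply: Jx | apply: Jy].
- by case: (maxM) => -[_ _ MM] _ _; apply: MM; apply: Jx.
Qed.

(* If M is a maximal left ideal and a is not in M, then {x | x * a \in M} is
   again a maximal left ideal. *)
Lemma maximal_left_ideal_residual (M : set R) a :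
  maximal_left_ideal M -> ~ M a -> maximal_left_ideal [set x | M (x * a)].
Proof.
move=> [lM _ maxM] Ma; have [M0 MD MM] := lM; split.
- split=> /= [|x y Mx My|b x Mx]; first by rewrite mul0r.
    by rewrite mulrDl; apply: MD.
  by rewrite -mulrA; apply: MM.
- move=> MT; apply: Ma; have : [set x | M (x * a)] 1 by rewrite MT.
  by rewrite /= mul1r.
move=> I lI sMI; have [I0 ID IM] := lI.
have [[i Ii Mi]|noI] := pselect (exists2 i, I i & ~ M (i * a)); last first.
  left; apply/seteqP; split=> // x Ix /=.
  by apply: contrapT => Mx; apply: noI; exists x.
right; pose K : set R := [set y | exists j m, [/\ I j, M m & y = j * a + m]].
have lK : left_ideal K.
  split=> [|y z [j [m [Ij Mm ->]]] [j' [m' [Ij' Mm' ->]]]|b y [j [m [Ij Mm ->]]]].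
  - by exists 0, 0; rewrite mul0r addr0.
  - exists (j + j'), (m + m'); split; [exact: ID | exact: MD |].
    by rewrite mulrDl addrACA.
  - exists (b * j), (b * m); split; [exact: IM | exact: MM |].
    by rewrite mulrDr mulrA.
have sMK : M `<=` K by move=> m Mm; exists 0, m; rewrite mul0r add0r.
have Ki : K (i * a) by exists i, 0; rewrite addr0.
have [KM|KT] := maxM K lK sMK; first by rewrite KM in Ki.
have [j [m [Ij Mm Ea]]] : K a by rewrite KT.
have I1j : I (1 - j).
  by apply: sMI => /=; rewrite mulrBl mul1r {1}Ea addrC addKr.
have I1 : I 1 by rewrite -(subrK j 1); apply: ID.
by apply/seteqP; split=> // x _; rewrite -[x]mulr1; apply: IM.
Qed.

Lemma jacobsonMr (x a : R) : jacobson_radical x -> jacobson_radical (x * a).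
Proof.
move=> Jx M maxM; have [Ma|Ma] := pselect (M a).
  by case: maxM => -[_ _ MM] _ _; apply: MM.
exact: (Jx _ (maximal_left_ideal_residual maxM Ma)).
Qed.

Definition jacobson_pred : {pred R} := fun x => `[< jacobson_radical x >].

Lemma jacobson_zmod_closed : zmod_closed jacobson_pred.
Proof.
have lJ := jacobson_left_ideal; have [J0 JD _] := lJ.
split=> [|x y /asboolP Jx /asboolP Jy]; first exact/asboolP.
by apply/asboolP; apply: JD => //; exact: left_idealN lJ Jy.
Qed.

HB.instance Definition _ :=
  GRing.isZmodClosed.Build R jacobson_pred jacobson_zmod_closed.

(* MathComp equips [Quotient.quot] with a multiplication only for commutative
   rings, hence the alias and the instance below. *)
Definition jacobson_quot : Type := Quotient.quot jacobson_pred.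

HB.instance Definition _ := GRing.Zmodule.on jacobson_quot.
HB.instance Definition _ :=
  EqQuotient.copy jacobson_quot (Quotient.quot jacobson_pred).

Definition jacobson_quot_one := lift_cst jacobson_quot 1.
Definition jacobson_quot_mul := lift_op2 jacobson_quot *%R.

Lemma jacobson_quot_eqP (x y : R) :
  \pi_jacobson_quot x = \pi y <-> jacobson_radical (x - y).
Proof.
split=> [/eqP|Jxy]; first by rewrite -Quotient.idealrBE => /asboolP.
by apply/eqP; rewrite -Quotient.idealrBE; apply/asboolP.
Qed.

Lemma pi_jacobson_quotM (x y : R) :
  \pi_jacobson_quot (x * y) = jacobson_quot_mul (\pi x) (\pi y).
Proof.
have [_ JD JM] := jacobson_left_ideal; unlock jacobson_quot_mul.
apply/jacobson_quot_eqP; set x' := repr _; set y' := repr _.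
have Jx : jacobson_radical (x - x') by apply/jacobson_quot_eqP; rewrite reprK.
have Jy : jacobson_radical (y - y') by apply/jacobson_quot_eqP; rewrite reprK.
have -> : x * y - x' * y' = (x - x') * y + x' * (y - y').
  by rewrite mulrBl mulrBr addrA subrK.
by apply: JD; [apply: jacobsonMr | apply: JM].
Qed.

Lemma pi_jacobson_quot1 : \pi_jacobson_quot 1 = jacobson_quot_one.
Proof. by unlock jacobson_quot_one. Qed.

Lemma pi_jacobson_quotD (x y : R) :
  \pi_jacobson_quot (x + y) = \pi x + \pi y.
Proof. exact: (@pi_addr _ _ _ _ _ (Quotient.quot jacobson_pred)). Qed.

Fact jacobson_quot_mulA : associative jacobson_quot_mul.
Proof.
move=> x y z; rewrite -[x]reprK -[y]reprK -[z]reprK.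
by rewrite -!pi_jacobson_quotM mulrA.
Qed.

Fact jacobson_quot_mul1 : left_id jacobson_quot_one jacobson_quot_mul.
Proof. by move=> x; rewrite -[x]reprK -pi_jacobson_quot1 -pi_jacobson_quotM mul1r. Qed.

Fact jacobson_quot_mulr1 : right_id jacobson_quot_one jacobson_quot_mul.
Proof. by move=> x; rewrite -[x]reprK -pi_jacobson_quot1 -pi_jacobson_quotM mulr1. Qed.

Fact jacobson_quot_mulDl : left_distributive jacobson_quot_mul +%R.
Proof.
move=> x y z; rewrite -[x]reprK -[y]reprK -[z]reprK.
by rewrite -!(pi_jacobson_quotD, pi_jacobson_quotM) mulrDl.
Qed.

Fact jacobson_quot_mulDr : right_distributive jacobson_quot_mul +%R.
Proof.
move=> x y z; rewrite -[x]reprK -[y]reprK -[z]reprK.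
by rewrite -!(pi_jacobson_quotD, pi_jacobson_quotM) mulrDr.
Qed.

HB.instance Definition _ := GRing.Zmodule_isPzRing.Build jacobson_quot
  jacobson_quot_mulA jacobson_quot_mul1 jacobson_quot_mulr1
  jacobson_quot_mulDl jacobson_quot_mulDr.

End JacobsonQuotient.

(* Main.v *)
(** Over a strongly nil *-clean ring, every idempotent equals its own projection
    part, since commuting idempotents whose difference is nilpotent coincide; then
    idempotents are central.  As x - x^2 is nilpotent for all x, taking x = -1 shows
    that 2 is nilpotent, and this makes the binomial expansion of a suitable power of
    p + w collapse to p, whence periodicity.  With central idempotents and
    periodicity, nilpotents lie in the radical: if w is nilpotent, some power of a w
    is a central idempotent, and it is 0 because it is a left multiple of w.
    Conversely the radical of a periodic ring is nil, and if R/J(R) is Boolean then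
    x - x^n lies in J(R) for every n > 0, in particular when x^n is idempotent. *)

Require Import Defs.
From mathcomp Require Import all_boot all_algebra.
From mathcomp Require Import boolp classical_sets.

Set Implicit Arguments.
Unset Strict Implicit.
Unset Printing Implicit Defensive.

Import GRing.Theory.

Local Open Scope classical_set_scope.
Local Open Scope ring_scope.

Lemma proper_left_ideal_sub_maximal (R : pzRingType) (I : set R) :
  left_ideal I -> ~ I 1 -> exists2 M, maximal_left_ideal M & I `<=` M.
Proof.
move=> lI I1; have [I0 ID IM] := lI.
(* Taking unions with I makes the empty chain bounded as well. *)
pose P : set (set R) := [set A | left_ideal (A `|` I) /\ ~ (A `|` I) 1].
have [F PF totF|A [[lA A1] maxA]] := @Zorn_bigcup R P.
  split; last by case=> // -[X FX X1]; apply: (PF X FX).2; left.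
  split=> [|x y Ux Uy|a x]; first by right.
  - have [X [sXU [_ XD _] Xx Xy]] : exists X,
        [/\ X `|` I `<=` \bigcup_(X in F) X `|` I, left_ideal (X `|` I),
            (X `|` I) x & (X `|` I) y].
      have sU X : F X -> X `|` I `<=` \bigcup_(X in F) X `|` I.
        by move=> FX z [Xz|Iz]; [left; exists X | right].
      case: Ux => [[X FX Xx]|Ix]; case: Uy => [[Y FY Yy]|Iy].
      + case: (totF X Y FX FY) => sXY.
          exists Y; split; [exact: sU | exact: (PF Y FY).1 | | by left].
          by left; apply: sXY.
        exists X; split; [exact: sU | exact: (PF X FX).1 | by left |].
        by left; apply: sXY.
      + exists X; split; [exact: sU | exact: (PF X FX).1 | by left | by right].
      + exists Y; split; [exact: sU | exact: (PF Y FY).1 | by right | by left].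
      + exists I; rewrite setUid; split=> //; by right.
    by apply: sXU; apply: XD.
  - case=> [[X FX Xx]|Ix]; last by right; apply: IM.
    have [_ _ XM] := (PF X FX).1.
    by case: (XM a x (or_introl Xx)) => [Xax|?]; [left; exists X | right].
exists (A `|` I); last by move=> x; right.
split=> // [AT|K lK sAK]; first by apply: A1; rewrite AT.
have [K1|K1] := pselect (K 1).
  right; apply/seteqP; split=> // x _.
  by have [_ _ KM] := lK; rewrite -[x]mulr1; apply: KM.
left; apply/seteqP; split=> // x Kx; apply: contrapT => nAx.
have KI : K `|` I = K.
  by apply/seteqP; split=> y; [case=> // Iy; apply: sAK; right | left].
have ltAK : A `<` K.
  by split=> [y Ay|sKA]; [apply: sAK; left | apply: nAx; left; apply: sKA].
have PK : P K by split; [rewrite KI | case].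
exact: maxA ltAK PK.
Qed.

(** Otherwise R(1 - x) is a proper left ideal, and a maximal left ideal above it contains both x and
    1 - x, hence 1. *)
Lemma jacobson_radical_quasi_regular (R : pzRingType) (x : R) :
  jacobson_radical x -> exists u, u * (1 - x) = 1.
Proof.
move=> Jx; apply: contrapT => nu.
pose I : set R := [set y | exists u, y = u * (1 - x)].
have lI : left_ideal I.
  split=> [|_ _ [u ->] [v ->]|a _ [u ->]]; first by exists 0; rewrite mul0r.
    by exists (u + v); rewrite mulrDl.
  by exists (a * u); rewrite mulrA.
have I1 : ~ I 1 by case=> u Eu; apply: nu; exists u.
have [M maxM sIM] := proper_left_ideal_sub_maximal lI I1.
have [[_ MD MM] MT _] := maxM; apply: MT; apply/seteqP; split=> // y _.
rewrite -[y]mulr1; apply: MM; rewrite -(subrK x 1); apply: MD; last exact: Jx.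
by apply: sIM; exists 1; rewrite mul1r.
Qed.

Lemma periodic_shift (R : pzRingType) (x : R) : periodic_ring R ->
  exists m d : nat, [/\ (0 < m)%N, (0 < d)%N & x ^+ (m + d) = x ^+ m].
Proof.
move=> perR; have [m [n [m0 n0 /eqP]]] := perR x.
rewrite neq_ltn => /orP[lt_mn|lt_nm] E.
  by exists m, (n - m)%N; rewrite subn_gt0 subnKC // ltnW.
by exists n, (m - n)%N; rewrite subn_gt0 subnKC // ltnW.
Qed.

(** Periodicity gives (1 - x^d) x^m = 0, and 1 - x^d has a left inverse because x^d lies in the
    radical. *)
Lemma periodic_jacobson_nil (R : pzRingType) (x : R) :
  periodic_ring R -> jacobson_radical x -> ring_nilpotent x.
Proof.
move=> perR Jx; have [m [d [m0 d0 Exmd]]] := periodic_shift x perR.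
have [_ _ JM] := jacobson_left_ideal R.
have [u Eu] : exists u, u * (1 - x ^+ d) = 1.
  apply: jacobson_radical_quasi_regular.
  by rewrite -(prednK d0) exprSr; apply: JM.
exists m => //; rewrite -[x ^+ m]mul1r -Eu -mulrA mulrBl mul1r.
by rewrite -exprD addnC Exmd subrr mulr0.
Qed.

Lemma periodic_idempotent_power (R : pzRingType) (x : R) :
  periodic_ring R -> exists2 n, (0 < n)%N & ring_idempotent (x ^+ n).
Proof.
move=> perR; have [m [d [m0 d0 Exmd]]] := periodic_shift x perR.
have per k i : (m <= i)%N -> x ^+ (i + k * d) = x ^+ i.
  move=> le_mi; elim: k => [|k IH]; first by rewrite addn0.
  by rewrite mulSnr addnA exprD IH -exprD -(subnK le_mi) -addnA exprD Exmd -exprD.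
(* The exponent [m * d] is at least [m], so doubling it adds [m] whole periods and changes
   nothing. *)
exists (m * d)%N; first by rewrite muln_gt0 m0.
by rewrite /ring_idempotent expr2 -exprD per // leq_pmulr.
Qed.

Lemma nilpotent_idempotent_eq0 (R : pzRingType) (e : R) :
  e * e = e -> ring_nilpotent e -> e = 0.
Proof.
move=> ee [[//|n] _ <-]; elim: n => [|n IH]; first by rewrite expr1.
by rewrite exprS -IH.
Qed.

(* For t in e R (1 - e), e + t is an idempotent, so it is fixed by star along with
   e; hence t = star t lies in (1 - e) R e as well and vanishes. *)
Lemma idempotent_star_projection_central (R : pzRingType) (star : R -> R) (e : R) :
  ring_involution star ->
  (forall f : R, ring_idempotent f -> star_projection star f) ->
  ring_idempotent e -> forall x, e * x = x * e.
Proof.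
move=> [starD starM starK] proj ide; have ee : e * e = e by rewrite -expr2.
have [_ se] := proj e ide.
have star0 : star 0 = 0 by apply: (@addrI _ (star 0)); rewrite -starD !addr0.
have corner t : e * t = t -> t * e = 0 -> t = 0.
  move=> et te; have tt : t * t = 0 by rewrite -[in X in _ * X]et mulrA te mul0r.
  have [_] : star_projection star (e + t).
    apply: proj; rewrite /ring_idempotent expr2 mulrDl !mulrDr.
    by rewrite ee et te tt !addr0.
  rewrite starD -se => /addrI st.
  by rewrite -et st {1}se -starM te star0.
have eye y : e * y = e * y * e.
  apply/eqP; rewrite -subr_eq0; apply/eqP/corner.
    by rewrite mulrBr !mulrA ee.
  by rewrite mulrBl -!mulrA ee subrr.
(* Since [star] fixes e and reverses products, [eye] at [star x] yields x e = e x e. *)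
move=> x; rewrite eye; apply: (can_inj starK).
by rewrite !starM -se mulrA [RHS]eye.
Qed.

(** Centrality lets the relation b w = e be iterated to b^k w^k e = e, whose left side vanishes for
    large k. *)
Lemma central_idempotent_nilpotent_multiple_eq0 (R : pzRingType) (e b w : R) :
  (forall x, e * x = x * e) -> e * e = e -> b * w = e -> ring_nilpotent w ->
  e = 0.
Proof.
move=> ec ee bw [n n0 wn0].
have bwn k : b ^+ k * w ^+ k * e = e.
  elim: k => [|k IH]; first by rewrite !expr0 !mul1r.
  rewrite exprSr exprS mulrA -[b ^+ k * b * w]mulrA bw -[_ * e * _]mulrA ec.
  by rewrite mulrA -mulrA ee IH.
by rewrite -(bwn n) wn0 mulr0 mul0r.
Qed.

(** If a maximal left ideal M misses w, then a w is 1 modulo M for some a, and so is each power of a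
    w; but one of these powers is 0. *)
Lemma nilpotent_jacobson (R : pzRingType) (w : R) :
  (forall e : R, ring_idempotent e -> forall x, e * x = x * e) ->
  periodic_ring R -> ring_nilpotent w -> jacobson_radical w.
Proof.
move=> central perR nw M [[M0 MD MM] MT maxM]; apply: contrapT => nMw.
pose K : set R := [set y | exists a m, M m /\ y = a * w + m].
have K1 : K 1.
  have [||KM|->//] := maxM K.
  - split=> [|_ _ [a [m [Mm ->]]] [b [l [Ml ->]]]|c _ [a [m [Mm ->]]]].
    + by exists 0, 0; rewrite mul0r addr0.
    + exists (a + b), (m + l); split; first exact: MD.
      by rewrite mulrDl addrACA.
    + by exists (c * a), (c * m); split; [exact: MM | rewrite mulrDr mulrA].
  - by move=> m Mm; exists 0, m; rewrite mul0r add0r.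
  - by case: nMw; rewrite -KM; exists 1, 0; rewrite mul1r addr0.
have [a [m [Mm E1]]] := K1.
have [[|n] // _ ide] := periodic_idempotent_power (a * w) perR.
have aw0 : (a * w) ^+ n.+1 = 0.
  apply: (central_idempotent_nilpotent_multiple_eq0 (central _ ide) _ _ nw).
    by rewrite -expr2.
  by rewrite exprSr mulrA.
have M1X k : M (1 - (a * w) ^+ k).
  elim: k => [|k IH]; first by rewrite subrr.
  rewrite -(subrK (a * w) 1) -addrA; apply: MD.
    by rewrite E1 addrAC subrr add0r.
  by rewrite exprS -{1}[a * w]mulr1 -mulrBr; apply: MM.
apply: MT; apply/seteqP; split=> // x _; rewrite -[x]mulr1; apply: MM.
by rewrite -[1]subr0 -aw0.
Qed.

Lemma idempotent_add_nilpotent_sub_sqr (R : pzRingType) (p w : R) :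
  p * p = p -> p * w = w * p -> ring_nilpotent w ->
  ring_nilpotent ((p + w) - (p + w) ^+ 2).
Proof.
move=> pp pw [n n0 wn0].
(* The second factor commutes with w, so the product inherits nilpotency from w. *)
have -> : (p + w) - (p + w) ^+ 2 = w * (1 - p - p - w).
  rewrite expr2 mulrDl !mulrDr !mulrN mulr1 pp -pw !opprD !addrA.
  by rewrite [p + w]addrC addrK.
exists n => //; rewrite exprMn_comm ?wn0 ?mul0r //.
by rewrite /GRing.comm !mulrBr !mulrBl mulr1 mul1r pw.
Qed.

(* w is a difference of commuting idempotents, so w^3 = w. *)
Lemma idempotent_add_nilpotent_eq0 (R : pzRingType) (p w : R) :
  p * p = p -> p * w = w * p -> ring_nilpotent w ->
  ring_idempotent (p + w) -> w = 0.
Proof.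
move=> pp pw [n n0 wn0]; rewrite /ring_idempotent expr2 => idpw.
have ww : w * w = w - p * w - p * w.
  move: idpw; rewrite mulrDl !mulrDr pp -pw -addrA => /addrI E.
  by rewrite -[X in X - _ - _]E [X in X - _ - _]addrC addrK addrC addKr.
have pww : p * (w * w) = - (p * w).
  by rewrite ww !mulrBr mulrA pp subrr sub0r.
have www : w * w * w = w.
  by rewrite {1}ww !mulrBl -mulrA pww opprK ww !subrK.
(* By w^3 = w, the nilpotent element w^2 is idempotent. *)
have w2_0 : w * w = 0.
  apply: nilpotent_idempotent_eq0; first by rewrite mulrA www.
  by exists n => //; rewrite exprMn_comm // wn0 mul0r.
by rewrite -www w2_0 mul0r.
Qed.

(* For 0 < i < n the index i divides n`!, so i 'C(N, i) = N 'C(N.-1, i.-1) makes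
   'C(N, i) a multiple of c. *)
Lemma idempotent_add_nilpotent_pow (R : pzRingType) (p w : R) c n :
  (0 < c)%N -> c%:R = 0 :> R -> p * p = p -> p * w = w * p -> w ^+ n = 0 ->
  (p + w) ^+ (c * n`!) = p.
Proof.
move=> c0 cR pp pw wn0; set N := (c * n`!)%N.
have N0 : (0 < N)%N by rewrite muln_gt0 c0 fact_gt0.
have pX k : p ^+ k.+1 = p by elim: k => // k IH; rewrite exprS IH.
rewrite exprDn_comm // big_ord_recl /= subn0 expr0 mulr1 bin0 mulr1n.
rewrite -{1}(prednK N0) pX big1 ?addr0 // => -[i /= ltiN] _; rewrite /bump add1n.
(* The exponent of w in this term is [i.+1]: from [n] on the power is 0, below [n] the coefficient
   is. *)
have [le_ni|lt_in] := leqP n i.+1.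
  by rewrite -(subnK le_ni) exprD wn0 !mulr0 mul0rn.
have /dvdnP[q Eq] : (c %| 'C(N, i.+1))%N.
  have /dvdnP[r Er] : (i.+1 %| n`!)%N by apply: dvdn_fact; apply: ltnW.
  rewrite -(@dvdn_pmul2l i.+1) // -mul_bin_diag /N Er -!mulnA.
  by rewrite mulnCA dvdn_mull // mulnCA mulnA dvdn_mulr // mulnC.
by rewrite Eq mulrnA -mulr_natr cR mulr0.
Qed.

Theorem theorem2p7 (R : pzRingType) (star : R -> R)
    (star_inv : ring_involution star) :
  strongly_nil_star_clean star <->
  [/\ forall e : R, ring_idempotent e -> star_projection star e,
      periodic_ring R
    & boolean_ring (jacobson_quot R)].
Proof.
split=> [clean|[proj perR boolJ] x]; last first.
  have Jxx : jacobson_radical (x ^+ 2 - x).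
    by apply/jacobson_quot_eqP; rewrite expr2 pi_jacobson_quotM; exact: boolJ.
  have [_ JD JM] := jacobson_left_ideal R.
  (* Induction through x^(k+2) - x = x (x^(k+1) - x) + (x^2 - x). *)
  have JX k : jacobson_radical (x ^+ k.+1 - x).
    elim: k => [|k IH]; first by rewrite subrr -(mul0r (x ^+ 2 - x)); apply: JM.
    rewrite -(subrK (x ^+ 2) (x ^+ k.+2)) -addrA; apply: JD => //.
    by rewrite exprS expr2 -mulrBr; apply: JM.
  have [[|n] // _ ide] := periodic_idempotent_power x perR.
  exists (x ^+ n.+1), (x - x ^+ n.+1); split.
  - exact: proj.
  - apply: periodic_jacobson_nil => //; rewrite -opprB.
    exact: left_idealN (jacobson_left_ideal R) (JX n).
  - by rewrite addrC subrK.
  - by rewrite mulrBl mulrBr -exprS -exprSr.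
have proj e : ring_idempotent e -> star_projection star e.
  move=> ide; have [p [w [pP nw Ee pw]]] := clean e.
  have pp : p * p = p by rewrite -expr2; case: pP.
  move: ide; rewrite Ee => /(idempotent_add_nilpotent_eq0 pp pw nw) ->.
  by rewrite addr0.
have nil_sub_sqr (x : R) : ring_nilpotent (x - x ^+ 2).
  have [p [w [[pp _] nw -> pw]]] := clean x.
  by apply: idempotent_add_nilpotent_sub_sqr => //; rewrite -expr2.
have [c c0 cR] : exists2 c, (0 < c)%N & c%:R = 0 :> R.
  have [k _ Ek] := nil_sub_sqr (-1).
  (* At -1 the difference x - x^2 is -2; squaring (-2)^k = 0 removes the sign. *)
  exists ((2 ^ 2) ^ k)%N; first by rewrite !expn_gt0.
  rewrite !natrX -(sqrrN 2%:R) exprAC.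
  by move: Ek; rewrite sqrrN expr1n -opprD => ->; rewrite expr0n.
have perR : periodic_ring R.
  move=> x; have [p [w [[pp _] [n n0 wn0] -> pw]]] := clean x.
  have N0 : (0 < c * n`!)%N by rewrite muln_gt0 c0 fact_gt0.
  have xN : (p + w) ^+ (c * n`!) = p.
    by apply: idempotent_add_nilpotent_pow => //; rewrite -expr2.
  (* If x^N = p is idempotent, then x^(2N) = x^N. *)
  exists (c * n`!)%N, (c * n`! * 2)%N; split=> //; first by rewrite muln_gt0 N0.
    by apply/eqP; rewrite -{1}[(c * n`!)%N]muln1 eqn_pmul2l.
  by rewrite xN exprM xN pp.
split=> // y; rewrite -[y]reprK /ring_idempotent expr2.
rewrite -[LHS](pi_jacobson_quotM (repr y) (repr y)); apply/esym/jacobson_quot_eqP.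
apply: nilpotent_jacobson => // e ide.
exact: (idempotent_star_projection_central star_inv proj ide).
Qed.
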